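(* Let $\mathcal{B}_0$ be an $[n,t]$ linear code over $\mathbb{F}_q$ and let $\mathcal{C}$ be an $[n,k]$ linear code over $\mathbb{F}_q$ with $1 \le k \leq n-t$, such that (a) $\mathcal{B}_0$ is a subcode of $\mathcal{C}^\perp$, and (b) every set $S \subseteq [n]$ that is a $k$-core of $\mathcal{B}_0$ is also a $k$-core of $\mathcal{C}^\perp$. Then the minimum distance of $\mathcal{C}$ is $$d_{\min}(\mathcal{C}) = n+1-g_k(\mathcal{B}_0),$$ where $g_k(\mathcal{B}_0)$ is the $k$-th gap number of $\mathcal{B}_0$.
   Context: An $[n,k]$ code is a $k$-dimensional linear subspace of $\mathbb{F}_q^n$; $\mathcal{C}^\perp$ is its dual; $[n]=\{1,\dots,n\}$; $\mathrm{supp}(\mathbf{c})$ is the set of nonzero coordinates of $\mathbf{c}$, and for a code $\mathcal{D}$, $\mathrm{supp}(\mathcal{D}) = \bigcup_{\mathbf{c}\in\mathcal{D}} \mathrm{supp}(\mathbf{c})$. Generalized Hamming weights (GHWs) and gaps: for a code $\mathcal{D}$ of length $n$ and dimension $t$ and $1 \le i \le t$, $d_i(\mathcal{D})$ is the minimum of $|\mathrm{supp}(\mathcal{D}')|$ over all $i$-dimensional subcodes $\mathcal{D}'$ of $\mathcal{D}$; these are strictly increasing in $i$. The gap numbers $g_1(\mathcal{D}) < g_2(\mathcal{D}) < \cdots < g_{n-t}(\mathcal{D})$ are the elements of $[n] \setminus \{d_i(\mathcal{D}) : 1 \le i \le t\}$ in increasing order. $\ell$-core: for a linear code $\mathcal{D}$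 of length $n$, a set $S \subseteq [n]$ with $|S| = \ell$ is an $\ell$-core of $\mathcal{D}$ if $\mathrm{supp}(\mathbf{c}) \not\subseteq S$ for every nonzero $\mathbf{c} \in \mathcal{D}$. *)

(* Defs.v *)
From HB Require Import structures.
From mathcomp Require Import all_boot all_order all_algebra.
Set Implicit Arguments.
Unset Strict Implicit.
Unset Printing Implicit Defensive.
Import GRing.Theory.
Local Open Scope ring_scope.

(* Over a finite field there are finitely many subspaces, so minima over
   subcodes can be taken as finite big operators. *)
Lemma span_enum_vspaceK (F : finFieldType) (n : nat) :
  cancel (fun U : {vspace 'rV[F]_n} => [set x in U])
         (fun A : {set 'rV[F]_n} => <<enum A>>%VS).
Proof.
move=> U; apply: subv_anti; apply/andP; split.
  by apply/span_subvP => x; rewrite mem_enum inE.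
by apply/subvP => x xU; apply: memv_span; rewrite mem_enum inE.
Qed.
HB.instance Definition _ (F : finFieldType) (n : nat) :=
  Countable.copy {vspace 'rV[F]_n} (can_type (@span_enum_vspaceK F n)).
HB.instance Definition _ (F : finFieldType) (n : nat) :
    isFinite {vspace 'rV[F]_n} :=
  CanIsFinite (@span_enum_vspaceK F n).

(* Coordinate positions are 0, ..., n.-1 (the type 'I_n); weights and gap
   numbers are natural numbers in 1, ..., n. *)

Definition supp (F : finFieldType) (n : nat) (c : 'rV[F]_n) : {set 'I_n} :=
  [set i | c 0 i != 0].

Definition csupp (F : finFieldType) (n : nat) (D : {vspace 'rV[F]_n}) :
    {set 'I_n} :=
  \bigcup_(c : 'rV[F]_n | c \in D) supp c.

Definition dual (F : finFieldType) (n : nat) (C : {vspace 'rV[F]_n}) :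
    {vspace 'rV[F]_n} :=
  (\bigcap_(c : 'rV[F]_n | c \in C)
     lker (linfun (fun x : 'rV[F]_n => x *m c^T)))%VS.

Lemma mem_dual (F : finFieldType) (n : nat) (C : {vspace 'rV[F]_n})
    (x : 'rV[F]_n) :
  reflect (forall c, c \in C -> \sum_(i < n) x 0 i * c 0 i = 0) (x \in dual C).
Proof.
have E (c : 'rV[F]_n) : (x \in lker (linfun (fun y : 'rV[F]_n => y *m c^T)))
         = (\sum_(i < n) x 0 i * c 0 i == 0).
  have -> : \sum_(i < n) x 0 i * c 0 i = (x *m c^T) 0 0.
    by rewrite mxE; apply: eq_bigr => i _; rewrite mxE.
  rewrite memv_ker (lfunE (mulmxr c^T)) /=; apply/eqP/eqP => [->|h].
    by rewrite mxE.
  by apply/matrixP => i j; rewrite !ord1 [RHS]mxE; exact: h.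
apply: (iffP idP) => [|h].
  by rewrite memvE => /subv_bigcapP h c /h; rewrite -memvE E => /eqP.
by rewrite memvE; apply/subv_bigcapP => c /h/eqP; rewrite -memvE E.
Qed.

(* Supports have at most n elements, so the default value n does not affect
   the minimum as soon as 1 <= i <= \dim D. *)
Definition ghw (F : finFieldType) (n : nat) (D : {vspace 'rV[F]_n}) (i : nat) :
    nat :=
  \big[minn/n]_(D' : {vspace 'rV[F]_n} | (D' <= D)%VS && (\dim D' == i))
    #|csupp D'|.

Definition gaps (F : finFieldType) (n : nat) (D : {vspace 'rV[F]_n}) : seq nat :=
  [seq j <- iota 1 n | j \notin [seq ghw D i | i <- iota 1 (\dim D)]].

(* The k-th gap number, counted from k = 1; the default 0 is only returned
   when k is not in 1, ..., n - \dim D. *)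
Definition gap (F : finFieldType) (n : nat) (D : {vspace 'rV[F]_n}) (k : nat) :
    nat :=
  nth 0%N (0%N :: gaps D) k.

Definition is_core (F : finFieldType) (n : nat) (D : {vspace 'rV[F]_n})
    (l : nat) (S : {set 'I_n}) : Prop :=
  #|S| = l /\ forall c, c \in D -> c != 0 -> ~~ (supp c \subset S).

Definition hdist (F : finFieldType) (n : nat) (x y : 'rV[F]_n) : nat :=
  #|[set i | x 0 i != y 0 i]|.

(* The default value n is immaterial when C is not the zero code. *)
Definition dmin (F : finFieldType) (n : nat) (C : {vspace 'rV[F]_n}) : nat :=
  \big[minn/n]_(p : 'rV[F]_n * 'rV[F]_n |
                [&& p.1 \in C, p.2 \in C & p.1 != p.2]) hdist p.1 p.2.

(* Main.v *)
Require Import Defs.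
From mathcomp Require Import all_boot all_order all_algebra.
From mathcomp Require Import zify.
Import GRing.Theory.
Local Open Scope nat_scope.

(** For a code [D] and a set [S] of coordinates, [S |-> #|S| - \dim (D_S)], with [D_S] the
    subcode of [D] supported in [S], is the rank function of a matroid whose independent
    sets are the cores of [D].  The number of gaps of [D] up to [m] is the least rank of an
    [m]-set, so [g_k] is the least [m] such that every [m]-set has rank at least [k], that
    is, contains a [k]-core.  If a nonzero codeword of [C] vanished on [g_k] coordinates, it
    would vanish on a [k]-core of [B0], hence of the dual of [C]; but the projection of [C]
    to such a core is injective.  Conversely a set of size [g_k - 1] and rank less than [k]
    for [B0] has rank less than [k] for the dual of [C], so some nonzero codeword of [C]
    vanishes on it. *)

(** * Finite minima and counting in integer intervals *)

Lemma bigminn_min (I : finType) (P : pred I) (f : I -> nat) (x : nat) (i0 : I) :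
  P i0 -> f i0 <= x ->
  exists2 i, P i & \big[minn/x]_(j | P j) f j = f i
                   /\ forall j, P j -> f i <= f j.
Proof.
move=> Pi0 fi0x; case: (arg_minnP f Pi0) => i Pi fmin; exists i => //.
split=> //; apply/eqP; rewrite eqn_leq; apply/andP; split.
  by rewrite -minEnat -leEnat Order.TotalTheory.bigmin_le_cond.
apply: (big_ind (fun m => f i <= m)) => //.
  exact: leq_trans (fmin _ Pi0) fi0x.
by move=> a b ha hb; rewrite leq_min ha.
Qed.

Lemma subset_card_between (T : finType) (A B : {set T}) (m : nat) :
  A \subset B -> #|A| <= m -> m <= #|B| ->
  exists X : {set T}, [/\ A \subset X, X \subset B & #|X| = m].
Proof.
move=> AB; elim: m => [|m IH] Am mB.
  by exists A; split=> //; lia.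
have [E|ne] := eqVneq #|A| m.+1; first by exists A.
have [||X [AX XB cX]] := IH; try lia.
have [x xB xX] : exists2 x, x \in B & x \notin X.
  by apply/subsetPn; apply/negP => /subset_leq_card; lia.
exists (x |: X); split; last by rewrite cardsU1 xX cX.
  exact: subset_trans AX (subsetUr _ _).
by rewrite subUset sub1set xB.
Qed.

(** The filtered list is increasing, so the entries before [g] are exactly the elements of [P] in
    [1, ..., g - 1]. *)
Lemma count_nth_filter_iota (P : pred nat) (n k : nat) :
  let s := filter P (iota 1 n) in let g := nth 0 s k in
  k < size s -> [/\ 0 < g, g <= n, P g & count P (iota 1 g.-1) = k].
Proof.
move=> s g ks.
have us : uniq s by rewrite filter_uniq ?iota_uniq.
have : g \in s by apply: mem_nth.
rewrite mem_filter mem_iota add1n ltnS => /and3P[Pg g0 gn]; split=> //.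
have Es : s = filter P (iota 1 g.-1) ++ g :: filter P (iota g.+1 (n - g)).
  rewrite /s; have -> : n = g.-1 + (n - g).+1 by lia.
  rewrite iotaD filter_cat add1n prednK //= Pg.
  by congr (_ ++ _ :: filter _ (iota _ _)); lia.
have := index_uniq 0 ks us; rewrite -/g {1}Es index_cat.
by rewrite mem_filter mem_iota add1n prednK // ltnn !andbF /= eqxx addn0 size_filter.
Qed.

(** As [d] is strictly increasing from [0], its values in [1, ..., m] are [d 1, ..., d N]. Thus [N]
    is the largest index with [d N <= m]. *)
Lemma count_image_iota (d : nat -> nat) (t m : nat) :
  let N := count (fun j => j \in [seq d i | i <- iota 1 t]) (iota 1 m) in
  d 0 = 0 -> {in [pred i | i <= t] &, {mono d : i j / i < j}} ->
  [/\ N <= t, d N <= m & forall i, i <= t -> d i <= m -> i <= N].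
Proof.
move=> N d0 dmono; set V := map d _ in N *.
have mono i j : i <= t -> j <= t -> (d i < d j) = (i < j) by move=> *; apply: dmono.
have uF : uniq (filter (fun j => j \in V) (iota 1 m)) by rewrite filter_uniq ?iota_uniq.
have Nt : N <= t.
  rewrite /N -size_filter -(size_iota 1 t) -(size_map d).
  by apply: uniq_leq_size => // j; rewrite mem_filter => /andP[].
split=> //.
  (* If [d N > m], the [N] values up to [m] would all have indices in [1, ..., N - 1]. *)
  rewrite leqNgt; apply/negP => mdN.
  have N0 : 0 < N by case: (N) mdN => //; rewrite d0.
  suff : N <= N.-1 by lia.
  rewrite {1}/N -size_filter -(size_iota 1 N.-1) -(size_map d).
  apply: uniq_leq_size => // j; rewrite mem_filter mem_iota => /andP[/mapP[i]].
  rewrite mem_iota => it -> dim; apply: map_f; rewrite mem_iota.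
  have := mono i N; have := mono N i; lia.
move=> i it dim; rewrite /N -size_filter -[leqLHS](size_iota 1) -(size_map d).
apply: uniq_leq_size.
  rewrite map_inj_in_uniq ?iota_uniq // => a b; rewrite !mem_iota => ha hb.
  have := mono a b; have := mono b a; lia.
move=> j /mapP[a]; rewrite mem_iota => ha ->; rewrite mem_filter.
rewrite map_f ?mem_iota /=; last by lia.
by have := mono 0 a; have := mono i a; rewrite d0; lia.
Qed.

(** * Coordinate subspaces and duality *)

Section Codes.
Variables (F : finFieldType) (n : nat).
Implicit Types (B C D U V : {vspace 'rV[F]_n}) (S T : {set 'I_n}) (c x : 'rV[F]_n).

(** Taken as a subspace, so that the subcode of [D] supported in [S] is [D :&: coordv S] and
    dimension formulas apply to it. *)
Definition coordv S : {vspace 'rV[F]_n} :=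
  (\sum_(i in S) <[delta_mx 0%R i : 'rV[F]_n]>)%VS.

Lemma mem_coordv S x : (x \in coordv S) = (supp x \subset S).
Proof.
apply/idP/subsetP => [/memv_sumP[v vP ->] j|sub].
  rewrite inE summxE; apply: contraR => jS; apply/eqP/big1 => i iS.
  have /vlineP[a ->] := vP i iS; rewrite !mxE eqxx /=.
  by case: eqP => [ji|_]; [rewrite ji iS in jS | rewrite mulr0].
rewrite [x]row_sum_delta; apply: memv_suml => i _.
have [iS|iS] := boolP (i \in S).
  by apply/memvZ/(subvP (sumv_sup i iS (subvv _))); rewrite memv_line.
suff -> : (x 0%R i = 0)%R by rewrite scale0r mem0v.
by apply/eqP; apply: contraNT iS => xi; apply: sub; rewrite inE.
Qed.

Lemma dim_coordv_le S : \dim (coordv S) <= #|S|.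
Proof.
apply: leq_trans (dimv_leq_sum _ _ _) _; rewrite -sum1_card.
by apply: leq_sum => i _; rewrite dim_vline; case: eqP.
Qed.

Lemma dim_rV m : \dim {: 'rV[F]_m} = m.
Proof. by rewrite dimvf /dim /= mul1n. Qed.

Lemma dim_le_n U : \dim U <= n.
Proof. by have := dimvS (subvf U); rewrite dim_rV. Qed.

Lemma coordvD S T : (coordv S + coordv T)%VS = coordv (S :|: T).
Proof.
apply: subv_anti; apply/andP; split.
  rewrite subv_add; apply/andP; split; apply/subvP => x; rewrite !mem_coordv.
    by move/subset_trans; apply; exact: subsetUl.
  by move/subset_trans; apply; exact: subsetUr.
apply/subv_sumP => i; rewrite inE -memvE => /orP[] iS.
  by apply/(subvP (addvSl _ _))/(subvP (sumv_sup i iS (subvv _))); rewrite memv_line.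
by apply/(subvP (addvSr _ _))/(subvP (sumv_sup i iS (subvv _))); rewrite memv_line.
Qed.

(** The upper bounds for [S] and its complement add up to [n], and the two subspaces span
    everything, so both bounds are attained. *)
Lemma dim_coordv S : \dim (coordv S) = #|S|.
Proof.
have := dim_coordv_le S; have := dim_coordv_le (~: S).
have := dimv_add_leqif (coordv S) (coordv (~: S)).
rewrite coordvD setUCr => -[+ _].
have -> : coordv [set: 'I_n] = fullv.
  by apply/vspaceP => x; rewrite mem_coordv subsetT memvf.
rewrite dim_rV; have := cardsC S; rewrite card_ord; lia.
Qed.

(** The dual is the kernel of multiplication by the transpose of a generator matrix [A]; since [A]
    has full row rank, this map is onto. *)
Lemma dim_dual C : \dim (dual C) = n - \dim C.
Proof.
pose A : 'M[F]_(\dim C, n) := (\matrix_(i, j) (vbasis C)`_i 0 j)%R.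
have rowA i : row i A = ((vbasis C)`_i)%R by apply/rowP => j; rewrite !mxE.
have fA : row_free A.
  have /freeP fr : free (vbasis C) by apply: basis_free (vbasisP C).
  apply: inj_row_free => v vA; apply/rowP => i; rewrite mxE.
  apply: (fr (fun j => v 0%R j)); rewrite -[RHS]vA mulmx_sum_row.
  by apply: eq_bigr => j _; rewrite rowA.
pose f : 'Hom('rV[F]_n, 'rV[F]_(\dim C)) := linfun (mulmxr A^T).
have kf : lker f = dual C.
  apply/vspaceP => x; rewrite memv_ker lfunE /=.
  apply/eqP/mem_dual => [xA c cC|h].
    rewrite (coord_vbasis cC).
    under eq_bigr => i _ do rewrite summxE mulr_sumr.
    rewrite exchange_big big1 // => j _.
    have := congr1 (fun y : 'rV_(_) => coord (vbasis C) j c * y 0 j)%R xA.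
    rewrite !mxE mulr0 mulr_sumr => xAj; rewrite -[RHS]xAj.
    by apply: eq_bigr => i _; rewrite !mxE mulrCA.
  apply/rowP => j; rewrite !mxE -[RHS](h ((vbasis C)`_j)%R).
    by apply: eq_bigr => i _; rewrite !mxE.
  by apply: vbasis_mem; rewrite mem_nth // size_tuple.
have imf : limg f = fullv.
  apply/eqP; rewrite eqEsubv subvf; apply/subvP => y _.
  apply/memv_imgP; exists (y *m pinvmx A^T)%R; rewrite ?memvf //.
  rewrite lfunE /= mulmxKpV // submx_full //.
  by rewrite /row_full mxrank_tr.
have := limg_ker_dim f fullv; rewrite capfv kf imf !dim_rV.
by move/(canRL (addnK _)).
Qed.

(** [coordv S] is the dual of [coordv (~: S)], and the dual of a sum is the intersection of the
    duals. *)
Lemma dual_capv_coordv C S : (dual C :&: coordv S)%VS = dual (C + coordv (~: S)).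
Proof.
apply/vspaceP => x; rewrite memv_cap mem_coordv.
apply/andP/mem_dual => [[/mem_dual xC /subsetP xS] c /memv_addP[u uC [v vS ->]]|h].
  transitivity (\sum_(i < n) x 0 i * u 0 i + \sum_(i < n) x 0 i * v 0 i)%R.
    by rewrite -big_split; apply: eq_bigr => i _; rewrite mxE mulrDr.
  rewrite xC // add0r; apply: big1 => i _.
  move: vS; rewrite mem_coordv => /subsetP/(_ i); have := xS i; rewrite !inE.
  case: eqP => [->|_ /(_ isT) iS]; first by rewrite mul0r.
  by case: eqP => [->|_ /(_ isT)]; rewrite ?mulr0 ?iS.
split; first by apply/mem_dual => c cC; apply/h/(subvP (addvSl _ _)).
apply/subsetP => i; rewrite inE; apply: contraR => iS; apply/eqP.
(* For [i] outside [S], orthogonality to the unit vector at [i], which lies in [coordv (~: S)],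
   forces [x] to vanish at [i]. *)
rewrite -[RHS](h (delta_mx 0%R i)).
  rewrite (bigD1 i) //= big1 ?addr0 => [|j ji]; rewrite mxE ?eqxx ?mulr1 //.
  by rewrite (negbTE ji) mulr0.
apply/(subvP (addvSr _ _)); rewrite mem_coordv; apply/subsetP => j.
by rewrite !inE mxE /=; apply: contraNN => jS; rewrite (_ : j == i = false) //; apply: contraNF iS => /eqP <-.
Qed.

(* Rank-nullity for the puncturing of C to S, whose dual is the shortening
   of the dual code. *)
Lemma dim_capv_coordvC C S :
  \dim (C :&: coordv (~: S)) + #|S| = \dim C + \dim (dual C :&: coordv S).
Proof.
rewrite dual_capv_coordv dim_dual.
have := dimv_sum_cap C (coordv (~: S)); have := dim_le_n (C + coordv (~: S)).
rewrite dim_coordv; have := cardsC S; rewrite card_ord; lia.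
Qed.

(** * Generalized Hamming weights and gap numbers *)

Lemma subv_dim_exists U i : i <= \dim U -> exists2 V, (V <= U)%VS & \dim V = i.
Proof.
move=> iU; exists <<take i (vbasis U)>>%VS.
  by apply/span_subvP => x /mem_take; exact: vbasis_mem.
have fr : free (vbasis U) by apply: basis_free (vbasisP U).
rewrite -(cat_take_drop i (vbasis U)) in fr.
by have /eqP -> := catl_free fr; rewrite size_takel ?size_tuple.
Qed.

Lemma csupp_sub D S : (csupp D \subset S) = (D <= coordv S)%VS.
Proof.
apply/bigcupsP/subvP => h c cD; first by rewrite mem_coordv h.
by rewrite -mem_coordv h.
Qed.

Lemma ghw_min D i : i <= \dim D ->
  exists2 V, (V <= D)%VS && (\dim V == i) & ghw D i = #|csupp V|
    /\ forall U, (U <= D)%VS -> \dim U = i -> #|csupp V| <= #|csupp U|.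
Proof.
move=> /subv_dim_exists[U UD Ui].
have PU : (U <= D)%VS && (\dim U == i) by rewrite UD Ui eqxx.
have cU : #|csupp U| <= n by rewrite -[leqRHS]card_ord max_card.
have [V PV [E m]] := @bigminn_min _ (fun V => (V <= D)%VS && (\dim V == i))
  (fun V => #|csupp V|) n U PU cU.
by exists V => //; split=> // W WD Wi; apply: m; rewrite WD Wi eqxx.
Qed.

Lemma ghw0 D : ghw D 0 = 0.
Proof.
have [//|V /andP[_]] := @ghw_min D 0; rewrite dimv_eq0 => /eqP -> [-> _].
by apply/eqP; rewrite cards_eq0 -subset0 csupp_sub sub0v.
Qed.

Lemma ghw_le D S i : i <= \dim (D :&: coordv S) -> ghw D i <= #|S|.
Proof.
move=> hi; have [U] := subv_dim_exists _ _ hi; rewrite subv_cap => /andP[UD US] Ui.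
have iD : i <= \dim D by rewrite -Ui dimvS.
have [V _ [-> m]] := ghw_min _ _ iD.
by apply: leq_trans (m U UD Ui) _; rewrite subset_leq_card ?csupp_sub.
Qed.

(** In an optimal subcode of dimension [i.+1], the words vanishing at a coordinate [j] of its
    support form a subcode of dimension at least [i] whose support misses [j]. *)
Lemma ghwS_gt D i : i < \dim D -> ghw D i < ghw D i.+1.
Proof.
move=> iD; have [V /andP[VD /eqP Vi] [-> _]] := ghw_min _ _ iD.
have [j jV] : exists j, j \in csupp V.
  apply/set0Pn; apply: contraL (ltn0Sn i) => /eqP V0.
  rewrite -Vi lt0n negbK dimv_eq0 -subv0.
  have := csupp_sub V set0; rewrite V0 subxx => /esym.
  by rewrite /coordv big_set0.
rewrite (cardsD1 j) jV add1n ltnS; apply: ghw_le.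
have -> : i = (\dim V).-1 by rewrite Vi.
have sub : (V :&: coordv (~: [set j]) <= D :&: coordv (csupp V :\ j))%VS.
  apply/subvP => x; rewrite !memv_cap !mem_coordv => /andP[xV xj].
  rewrite (subvP VD) //= setDE subsetI xj andbT.
  exact: (bigcup_sup x).
apply: leq_trans (dimvS sub).
have := dimv_sum_cap V (coordv (~: [set j])); have := dim_le_n (V + coordv (~: [set j])).
rewrite dim_coordv; have := cardsC [set j]; rewrite cards1 card_ord; lia.
Qed.

Lemma ghw_mono D : {in [pred i | i <= \dim D] &, {mono ghw D : i j / i < j}}.
Proof.
have lt i j : i < j -> j <= \dim D -> ghw D i < ghw D j.
  elim: j => // j IH; rewrite ltnS leq_eqVlt => /predU1P[->|ij] jD.
    exact: ghwS_gt.
  by apply: ltn_trans (ghwS_gt _ _ jD); apply: IH => //; exact: ltnW.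
move=> i j iD jD; case: (ltngtP i j) => [ij|ji|->]; last by rewrite ltnn.
  by rewrite lt.
by apply/negbTE; rewrite -leqNgt ltnW // lt.
Qed.

(** Describes the gap number by ranks: every set of that size has rank at least [k], some set with
    one element less does not. Sums replace differences because subtraction of naturals
    truncates. *)
Lemma gapP D k : 0 < k -> k <= n - \dim D ->
  [/\ 0 < gap D k, gap D k <= n,
      forall S, #|S| = gap D k -> \dim (D :&: coordv S) + k <= #|S|
    & exists2 S : {set 'I_n},
        #|S| = (gap D k).-1 & #|S| < \dim (D :&: coordv S) + k].
Proof.
(* From here [k] is the index in [gaps D], one less than the number of the gap: exactly [k] gaps
   precede it. *)
case: k => // k _ kD; rewrite /gap /=.
set V := [seq ghw D i | i <- iota 1 (\dim D)].
have cnt m : count (fun j => j \in V) (iota 1 m) +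
             count (fun j => j \notin V) (iota 1 m) = m.
  by rewrite -[RHS](size_iota 1) -(count_predC (fun j => j \in V)).
have cm m := @count_image_iota (ghw D) (\dim D) m (ghw0 D) (ghw_mono D).
(* At most [\dim D] of the integers [1, ..., n] are weights, so at least [n - \dim D] are gaps. *)
have ks : k < size (gaps D).
  rewrite size_filter -(ltn_add2l (count (fun j => j \in V) (iota 1 n))) cnt.
  have [cV _ _] := cm n.
  by apply: leq_ltn_trans (leq_add cV (leqnn k)) _; rewrite -ltn_subRL.
have [g0 gn gV cg] := count_nth_filter_iota _ _ _ ks.
rewrite -/(gaps D) in g0 gn gV cg.
set g := nth 0 (gaps D) k in g0 gn gV cg *.
have cg' : count (fun j => j \notin V) (iota 1 g) = k.+1.
  rewrite -[in iota 1 g](prednK g0) -[g.-1.+1]addn1 iotaD count_cat cg add1n prednK //=.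
  by rewrite gV !addn0 addn1.
split=> //.
  move=> S cS; have [_ _ /(_ (\dim (D :&: coordv S)))] := cm g.
  rewrite -cS ghw_le // dimvS ?capvSl // => /(_ isT isT).
  by have := cnt g; rewrite -/V cg' cS; lia.
have [Nt dN _] := cm g.-1; rewrite -/V in Nt dN.
have := cnt g.-1; rewrite cg; set N := count _ _ in Nt dN * => NE.
have [U /andP[UD /eqP UN] [EU _]] := ghw_min _ _ Nt.
rewrite EU in dN.
(* The set of small rank is the support of an optimal subcode of dimension [N], enlarged to size
   [g.-1]. *)
have [S US cS] : exists2 S : {set 'I_n}, csupp U \subset S & #|S| = g.-1.
  have [||S [? _ ?]] := @subset_card_between _ (csupp U) setT g.-1 (subsetT _).
  - by [].
  - by rewrite cardsT card_ord; lia.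
  - by exists S.
exists S => //; rewrite cS -NE addnS ltnS leq_add2r.
by rewrite -UN dimvS // subv_cap UD -csupp_sub.
Qed.

(** * Cores and minimum distance *)

(** Deleting from [S] a coordinate in the support of a nonzero word of [D :&: coordv S] lowers that
    dimension, so the inequality survives. Once the intersection is zero, any [k] elements of [S]
    form a core. *)
Lemma core_subset D S k : \dim (D :&: coordv S) + k <= #|S| ->
  exists2 T : {set 'I_n}, T \subset S & is_core D k T.
Proof.
elim: {S}_.+1 {-2}S (ltnSn #|S|) => // m IH S; rewrite ltnS => Sm kS.
have [D0|] := eqVneq (D :&: coordv S)%VS 0%VS.
  have [||T [_ TS Tk]] := @subset_card_between _ set0 S k (sub0set _).
  - by rewrite cards0.
  - by lia.
  exists T => //; split=> // c cD; apply: contraNN => cT.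
  by rewrite -memv0 -D0 memv_cap cD mem_coordv (subset_trans cT).
rewrite -vpick0; set c := vpick _ => c0.
have : c \in (D :&: coordv S)%VS by exact: memv_pick.
rewrite memv_cap mem_coordv => /andP[cD cS].
have [i ci] : exists i, i \in supp c.
  apply/existsP; apply: contraR c0; rewrite negb_exists => /forallP c0.
  by apply/eqP/rowP => i; have := c0 i; rewrite inE negbK mxE => /eqP.
have iS := subsetP cS i ci.
have lt : \dim (D :&: coordv (S :\ i)) < \dim (D :&: coordv S).
  have sub : (D :&: coordv (S :\ i) <= D :&: coordv S)%VS.
    apply: capvS => //; apply/subvP => x; rewrite !mem_coordv => /subset_trans; apply.
    exact: subD1set.
  rewrite ltn_neqAle dimvS // andbT dimv_leqif_eq //.
  apply: contraTneq ci => E; have : c \in (D :&: coordv (S :\ i))%VS.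
    by rewrite E memv_cap cD mem_coordv.
  rewrite memv_cap mem_coordv => /andP[_ /subsetP cSi].
  by apply/negP => /cSi; rewrite !inE eqxx.
rewrite (cardsD1 i) iS in Sm kS.
have [||T TS Tc] := IH (S :\ i); try lia.
by exists T => //; apply: subset_trans TS _; exact: subD1set.
Qed.

Lemma hdistE x y : hdist x y = #|supp (x - y)%R|.
Proof. by apply: eq_card => i; rewrite !inE !mxE subr_eq0. Qed.

Lemma dminP C : 0 < \dim C ->
  exists2 c, (c \in C) && (c != 0%R) & dmin C = #|supp c|
    /\ forall x, x \in C -> x != 0%R -> #|supp c| <= #|supp x|.
Proof.
rewrite lt0n dimv_eq0 -vpick0 => c0.
pose P (p : 'rV[F]_n * 'rV[F]_n) := [&& p.1 \in C, p.2 \in C & p.1 != p.2].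
have Pp x : x \in C -> x != 0%R -> P (x, 0%R) by rewrite /P /= => -> ->; rewrite mem0v.
have le x y : hdist x y <= n by rewrite -[leqRHS]card_ord max_card.
have [p /and3P[p1 p2 p12] [E m]] :=
  @bigminn_min _ P (fun p => hdist p.1 p.2) n _ (Pp _ (memv_pick C) c0) (le _ _).
exists (p.1 - p.2)%R; first by rewrite rpredB //= subr_eq0.
rewrite -hdistE; split=> // x xC x0.
by rewrite -[x in supp x]subr0 -hdistE; exact: (m (x, 0%R)) (Pp _ xC x0).
Qed.

End Codes.

Theorem mainTheorem4 (F : finFieldType) (n t k : nat)
    (B0 C : {vspace 'rV[F]_n})
    (dimB0 : \dim B0 = t) (dimC : \dim C = k)
    (k_ge1 : 1 <= k) (k_le : k <= n - t)
    (subB0 : (B0 <= dual C)%VS)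
    (coreB0 : forall S : {set 'I_n}, is_core B0 k S -> is_core (dual C) k S) :
  dmin C = n + 1 - gap B0 k.
Proof.
rewrite -dimB0 in k_le.
have [g0 gn gS [S cS Sk]] := gapP _ _ B0 k k_ge1 k_le.
rewrite -dimC in k_ge1.
have [c /andP[cC c0] [-> cmin]] := dminP _ _ C k_ge1.
have cardC (T : {set 'I_n}) : #|T| + #|~: T| = n by rewrite cardsC card_ord.
apply/eqP; rewrite eqn_leq; apply/andP; split.
  (* The intersection has dimension [k + \dim (dual C :&: coordv S) - #|S|], and [subB0] bounds the
     middle term below by the dimension for [B0]. *)
  have dS : 0 < \dim (C :&: coordv F n (~: S)).
    have := dim_capv_coordvC _ _ C S.
    have := dimvS (capvS subB0 (subvv (coordv F n S))); lia.
  move: dS; rewrite lt0n dimv_eq0 -vpick0 => x0.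
  have := memv_pick (C :&: coordv F n (~: S))%VS; rewrite memv_cap mem_coordv.
  case/andP=> xC /subset_leq_card xS.
  by have := cmin _ xC x0; have := cardC S; lia.
rewrite leqNgt; apply/negP => lt.
(* A word of weight below [n + 1 - gap B0 k] has at least [gap B0 k] zeros; [Z] consists of exactly
   that many. *)
have [||Z [_ Zc cZ]] := @subset_card_between _ set0 (~: supp c) (gap B0 k) (sub0set _).
- by rewrite cards0.
- by have := cardC (supp c); lia.
have := gS _ cZ => /core_subset[T TZ /coreB0[Tk Tcore]].
(* As [#|T|] equals [\dim C] and [T] is a core of the dual, rank-nullity leaves no nonzero word of
   [C] vanishing on [T], yet [c] does. *)
have := dim_capv_coordvC _ _ C T.
have -> : (dual C :&: coordv F n T)%VS = 0%VS.
  apply/eqP; rewrite -vpick0; apply: contraT => x0.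
  have := memv_pick (dual C :&: coordv F n T)%VS; rewrite memv_cap mem_coordv.
  by case/andP=> xC; apply: contraLR => _; exact: Tcore.
rewrite dimv0 dimC Tk => dT.
have : c \in (C :&: coordv F n (~: T))%VS.
  rewrite memv_cap cC mem_coordv -disjoints_subset disjoint_sym disjoints_subset.
  exact: subset_trans TZ Zc.
suff -> : (C :&: coordv F n (~: T))%VS = 0%VS by rewrite memv0 (negbTE c0).
by apply/eqP; rewrite -dimv_eq0; lia.
Qed.
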